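(* For every integer $n>1$ and every odd integer $q\ge 3$ there exists a $2$-stochastic $(n+2)$-dimensional matrix of order $q$ whose permanent is zero.
   Context: An $d$-dimensional matrix of order $q$ is an array $M=(M(\alpha))_{\alpha\in\{1,\dots,q\}^d}$ of real numbers. A $t$-dimensional plane of $M$ is the set of entries obtained by fixing $d-t$ of the coordinates at given values. $M$ is $t$-stochastic if it is nonnegative and the sums of entries over all $t$-dimensional planes are equal. A diagonal of $M$ is a set of $q$ entries $\alpha^1,\dots,\alpha^q$ such that for each coordinate $s\in\{1,\dots,d\}$ the values $\alpha^1_s,\dots,\alpha^q_s$ are pairwise distinct. The permanent of $M$ is the sum, over all diagonals, of the product of the entries of the diagonal. *)

(* Defs.v *)
From mathcomp Require Import all_boot all_order all_algebra.
From mathcomp Require Import reals.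

Set Implicit Arguments.
Unset Strict Implicit.
Unset Printing Implicit Defensive.

Import Order.TTheory GRing.Theory Num.Theory.
Local Open Scope ring_scope.

(* Coordinate values are 0, ..., q - 1 instead of 1, ..., q. *)
Notation mindex d q := {ffun 'I_d -> 'I_q}.
Notation mdmatrix R d q := {ffun mindex d q -> R}.

(* The cells that agree with a on the set S of fixed coordinates. *)
Definition plane (d q : nat) (S : {set 'I_d}) (a : mindex d q) :
    {set mindex d q} :=
  [set x : mindex d q | [forall s in S, x s == a s]].

(* A t-dimensional plane fixes d - t coordinates; the condition #|S| + t = d
   avoids truncated subtraction.  The common value c of the sums is
   unrestricted, so the zero matrix is t-stochastic. *)
Definition t_stochastic (R : realType) (d q t : nat) (M : mdmatrix R d q) :
    Prop :=
  (forall x, 0 <= M x) /\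
  exists c : R, forall (S : {set 'I_d}) (a : mindex d q),
    (#|S| + t = d)%N -> \sum_(x in plane S a) M x = c.

Definition diagonal (d q : nat) (D : {set mindex d q}) : bool :=
  (#|D| == q) &&
  [forall s : 'I_d, forall x : mindex d q in D, forall y : mindex d q in D,
     (x != y) ==> (x s != y s)].

Definition permanent (R : realType) (d q : nat) (M : mdmatrix R d q) : R :=
  \sum_(D : {set mindex d q} | diagonal D) \prod_(x in D) M x.

(* Main.v *)
Require Import Defs.
From mathcomp Require Import all_boot all_order all_algebra.
From mathcomp Require Import reals.

(** Identify the coordinate values with Z/q, single out one coordinate o, and
    let M be the indicator of the cells x with
      [\sum_(i != o) x i = 1] if [x o = 0],  [\sum_(i != o) x i = 0] otherwise.
    On a 2-dimensional plane at least one free coordinate j differs from o;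
    the other free coordinate can be chosen arbitrarily and x j is then
    determined, so every plane sum is q.  On a diagonal each coordinate runs
    through Z/q, whose elements add up to 0 because q is odd; hence adding the
    defining equations of M over a diagonal would give 0 = 1. *)

Set Implicit Arguments.
Unset Strict Implicit.
Unset Printing Implicit Defensive.

Import Order.TTheory GRing.Theory Num.Theory.
Local Open Scope ring_scope.

Definition sum_except (d q : nat) (o : 'I_d) (x : mindex d q.+1) : 'I_q.+1 :=
  \sum_(i | i != o) x i.

(** The right-hand side [c] stays arbitrary: the plane sums do not depend on it, and the permanent
    argument needs only [\sum_v c v != 0]. *)
Definition sum_matrix (R : realType) (d q : nat) (o : 'I_d)
    (c : 'I_q.+1 -> 'I_q.+1) : mdmatrix R d q.+1 :=
  [ffun x => (sum_except o x == c (x o))%:R].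

(** Negation permutes the summands, so the sum is killed by 2; it is also killed by the odd number
    [q.+1]. *)
Lemma sum_ord_odd (q : nat) : odd q.+1 -> \sum_(v : 'I_q.+1) v = 0.
Proof.
move=> q_odd; set s := \sum_v v.
have ss0 : s + s = 0.
  have -> : s + s = s - s; last exact: subrr.
  congr (_ + _); rewrite /s -sumrN.
  by rewrite [LHS](reindex_inj oppr_inj).
have sq0 : s *+ q.+1 = 0.
  by apply: val_inj; rewrite Zp_mulrn /= modnMl.
rewrite -sq0 -[in RHS](odd_double_half q.+1) q_odd mulrnDr mulr1n.
by rewrite -mul2n mulrnA mulr2n ss0 mul0rn addr0.
Qed.

(** By counting, [x |-> x s] is a bijection from [D] onto ['I_q]. *)
Lemma sum_diagonal (V : nmodType) (d q : nat) (D : {set mindex d q}) (s : 'I_d)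
    (F : 'I_q -> V) :
  diagonal D -> \sum_(x in D) F (x s) = \sum_v F v.
Proof.
case/andP=> /eqP cardD /forallP/(_ s)/forall_inP distinct.
have inj : {in D &, injective (fun x : mindex d q => x s)}.
  move=> x y xD yD /eqP xy; apply/eqP; apply: contraTT xy => neq_xy.
  by have /forall_inP/(_ y yD)/implyP/(_ neq_xy) := distinct x xD.
have imD : [set x s | x : mindex d q in D] = [set: 'I_q].
  apply/eqP; rewrite eqEcard subsetT cardsT card_ord card_in_imset //.
  by rewrite cardD leqnn.
by rewrite -(big_imset _ inj) imD; apply: eq_bigl => v; rewrite inE.
Qed.

Lemma sum_matrix_plane (R : realType) (d q : nat) (o : 'I_d)
    (c : 'I_q.+1 -> 'I_q.+1) (S : {set 'I_d}) (a : mindex d q.+1) :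
  (#|S| + 2 = d)%N -> \sum_(x in plane S a) sum_matrix R o c x = q.+1%:R.
Proof.
move=> cardS.
have [j [k [neq_jo neq_jk freeE]]] :
    exists j k, [/\ j != o, j != k & ~: S = [set j; k]].
  have /cards2P[j [k [neq_jk freeE]]] : #|~: S| == 2.
    by rewrite -(eqn_add2l #|S|) cardsC card_ord cardS.
  have [eq_jo|neq_jo] := eqVneq j o; last by exists j, k.
  by exists k, j; rewrite -eq_jo eq_sym setUC.
have inS i : (i \in S) = (i != j) && (i != k).
  by rewrite -[S]setCK freeE !inE negb_or.
(* [g v] is the only cell of the plane with value [v] at [k] and entry 1: since [j != o], the target
   [c (y v o)] is known before coordinate [j] is solved for. *)
pose y v : mindex d q.+1 := [ffun i => if i == k then v else a i].
pose g v : mindex d q.+1 := [ffun i => if i == j then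
  c (y v o) - \sum_(i | (i != o) && (i != j)) y v i else y v i].
have gk v : g v k = v by rewrite !ffunE eq_sym (negPf neq_jk) eqxx.
have go v : g v o = y v o by rewrite ffunE eq_sym (negPf neq_jo).
have sum_g v : sum_except o (g v) = c (g v o).
  rewrite /sum_except (bigD1 j) //= go [g v j]ffunE eqxx.
  rewrite [X in _ + X](eq_bigr (y v)) ?subrK // => i /andP[_ neq_ij].
  by rewrite ffunE (negPf neq_ij).
rewrite (eq_bigr (fun x : mindex d q.+1 => (sum_except o x == c (x o))%:R));
  last by move=> x _; rewrite ffunE.
rewrite -natr_sum /nat_of_bool -big_mkcondr sum1_card; congr _%:R.
transitivity #|g @: [set: 'I_q.+1]|; last first.
  have g_inj : injective g by move=> u v eq_g; rewrite -(gk u) eq_g gk.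
  by rewrite (card_imset _ g_inj) cardsT card_ord.
apply: eq_card => x; rewrite unfold_in inE.
apply/andP/imsetP => [[/forall_inP xS /eqP sum_x] | [v _ ->]].
  exists (x k); rewrite ?inE //.
  have xy i : i != j -> x i = y (x k) i.
    move=> neq_ij; rewrite ffunE; case: eqVneq => [-> // | neq_ik].
    by apply/eqP/xS; rewrite inS neq_ij.
  apply/ffunP=> i; rewrite ffunE; case: eqVneq => [-> | /xy //].
  rewrite -xy 1?eq_sym // -sum_x /sum_except (bigD1 j) //=.
  rewrite [X in _ = _ + X - _](eq_bigr (y (x k))) ?addrK // => i0 /andP[_].
  exact: xy.
split; last by rewrite sum_g.
apply/forall_inP=> i; rewrite inS => /andP[neq_ij neq_ik].
by rewrite !ffunE (negPf neq_ij) (negPf neq_ik).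
Qed.

Lemma sum_matrix_stochastic (R : realType) (d q : nat) (o : 'I_d)
    (c : 'I_q.+1 -> 'I_q.+1) : t_stochastic 2 (sum_matrix R o c).
Proof.
split; first by move=> x; rewrite ffunE ler0n.
by exists q.+1%:R; apply: sum_matrix_plane.
Qed.

Lemma sum_matrix_permanent (R : realType) (d q : nat) (o : 'I_d)
    (c : 'I_q.+1 -> 'I_q.+1) :
  odd q.+1 -> \sum_v c v != 0 -> permanent (sum_matrix R o c) = 0.
Proof.
move=> q_odd c_neq0; apply: big1 => D diagD; apply/eqP.
(* A nonzero product forces the defining equation at every cell of [D]. *)
apply: contraNT c_neq0 => /prodf_neq0 M_neq0.
rewrite -(sum_diagonal o c diagD).
rewrite (eq_bigr (sum_except o)); last first.
  move=> x /M_neq0; rewrite ffunE pnatr_eq0 eqb0 negbK.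
  by move/eqP.
rewrite exchange_big big1 // => i _.
by rewrite (sum_diagonal i id diagD) sum_ord_odd.
Qed.

Theorem theorem4 (R : realType) (n q : nat) :
  (1 < n)%N -> odd q -> (3 <= q)%N ->
  exists M : mdmatrix R (n + 2) q,
    [/\ t_stochastic 2 M, M != 0 & permanent M = 0].
Proof.
(* The form [q.+2] makes ['I_q.+2] a nontrivial ring, where [1 != 0]. *)
case: q => [|[|q]] // _ q_odd _.
have o : 'I_(n + 2) by rewrite addn2; exact: ord0.
pose c (v : 'I_q.+2) : 'I_q.+2 := if v == 0 then 1 else 0.
exists (sum_matrix R o c); split; first exact: sum_matrix_stochastic.
  (* At this cell the target is [c 1 = 0] and the other coordinates add up to 0, so the entry is
     1. *)
  apply/eqP=> /ffunP/(_ [ffun i => if i == o then 1 else 0]).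
  rewrite !ffunE eqxx /c oner_eq0 /sum_except big1 ?eqxx => [/eqP|i neq_io].
    by rewrite oner_eq0.
  by rewrite ffunE (negPf neq_io).
apply: sum_matrix_permanent => //.
by rewrite /c -big_mkcond big_pred1_eq oner_eq0.
Qed.
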